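(* Assume Martin's Axiom for $\sigma$-centered partial orderings. Then there is an $\omega^2$-ultrafilter on $\omega$ that is not a nowhere dense ultrafilter.
   Context: For $\alpha\le\omega_1$, an ultrafilter $u$ on $\omega$ is an $\alpha$-ultrafilter if for every $F:\omega\to\omega_1$ there is $A\in u$ such that the order type of $F(A)$ is $\le\alpha$. Here $\omega^2$ denotes the ordinal power. An ultrafilter $u$ on $\omega$ is nowhere dense if for every $F:\omega\to{}^\omega2$ there is $A\in u$ such that $F(A)$ is nowhere dense in the Cantor space ${}^\omega 2$. Martin's Axiom for $\sigma$-centered partial orderings: for every $\sigma$-centered partial ordering $P$ (a countable union of centered subsets, where a subset is centered if any finitely many of its elements have a common lower bound in $P$) and every family of fewer than $2^{\aleph_0}$ dense subsets of $P$, there is a filter on $P$ meeting all of them. *)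

(* Defs.v *)
From HB Require Import structures.
From mathcomp Require Import all_boot all_order.
From mathcomp Require Import mathcomp_extra boolp contra classical_sets functions.
From mathcomp Require Import cardinality wochoice filter topology cantor.

Set Implicit Arguments.
Unset Strict Implicit.
Unset Printing Implicit Defensive.

Import Order.TTheory.
Local Open Scope classical_set_scope.
Local Open Scope card_scope.
Local Open Scope order_scope.

(* The ordinal omega_1 is realized inside a fixed well-ordering of the subsets
   of nat, as the set of those points that have only countably many
   predecessors.  Lemmas omega1_wo, omega1_countable_segment and
   omega1_uncountable show that the result is an uncountable well-order all of
   whose proper initial segments are countable, which determines it up to
   isomorphism. *)
Definition wo_le : rel (set nat) := sval (well_ordering_principle (set nat)).

Lemma wo_leP : well_order wo_le.
Proof. exact: svalP. Qed.

Lemma wo_le_total : total wo_le.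
Proof.
move=> x y; have [|z [[zA zm] _]] := wo_leP (A := [pred t | (t == x) || (t == y)]).
  by exists x; rewrite inE eqxx.
have zx : wo_le z x by apply: zm; rewrite inE eqxx.
have zy : wo_le z y by apply: zm; rewrite inE eqxx orbT.
by move: zA; rewrite inE => /orP[]/eqP ?; subst z; rewrite ?zx ?zy ?orbT.
Qed.

Lemma wo_le_refl : reflexive wo_le.
Proof. by move=> x; have := wo_le_total x x; rewrite orbb. Qed.

Lemma wo_le_anti : antisymmetric wo_le.
Proof.
move=> x y /andP[xy yx].
have [|z [_ zu]] := wo_leP (A := [pred t | (t == x) || (t == y)]).
  by exists x; rewrite inE eqxx.
rewrite -(zu x) ?(zu y) //; split; rewrite ?inE ?eqxx ?orbT// => t;
  by rewrite inE => /orP[]/eqP->//; exact: wo_le_refl.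
Qed.

Lemma wo_le_trans : transitive wo_le.
Proof.
move=> y x z xy yz.
have [|t [[tA tm] _]] := wo_leP (A := [pred t | [|| t == x, t == y | t == z]]).
  by exists x; rewrite inE eqxx.
have tx : wo_le t x by apply: tm; rewrite inE eqxx.
have ty : wo_le t y by apply: tm; rewrite inE eqxx orbT.
have tz : wo_le t z by apply: tm; rewrite inE eqxx !orbT.
move: tA; rewrite inE => /or3P[]/eqP ?; subst t => //.
  by rewrite (@wo_le_anti x y) ?xy ?tx.
by rewrite (@wo_le_anti z y) ?ty ?yz.
Qed.

Definition omega1 : Type := {x : set nat | `[< countable [set y | wo_le y x] >]}.

HB.instance Definition _ := Choice.on omega1.

Definition omega1_le : rel omega1 := fun x y => wo_le (val x) (val y).

Lemma omega1_le_refl : reflexive omega1_le.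
Proof. by move=> x; exact: wo_le_refl. Qed.

Lemma omega1_le_anti : antisymmetric omega1_le.
Proof. by move=> x y /wo_le_anti/val_inj. Qed.

Lemma omega1_le_trans : transitive omega1_le.
Proof. by move=> y x z; exact: wo_le_trans. Qed.

Lemma omega1_le_total : total omega1_le.
Proof. by move=> x y; exact: wo_le_total. Qed.

Fact omega1_display : Order.disp_t. Proof. exact: Order.Disp tt tt. Qed.

HB.instance Definition _ := Order.Le_isPOrder.Build omega1_display omega1
  omega1_le_refl omega1_le_anti omega1_le_trans.
HB.instance Definition _ :=
  Order.POrder_isTotal.Build omega1_display omega1 omega1_le_total.

Lemma omega1_wo : well_order (<=%O : rel omega1).
Proof.
apply: antisymmetric_well_order; first exact: le_anti.
move=> A [a aA].
have [|z [[zA zm] _]] :=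
    wo_leP
      (A := [pred t | `[< exists2 x, x \in A & val x = t >] ]).
  by exists (val a); apply/asboolP; exists a.
move: zA => /asboolP[z' z'A zE]; subst z.
exists z'; split=> // x xA; apply: zm.
by apply/asboolP; exists x.
Qed.

Lemma omega1_countable_segment (x : omega1) : countable [set y | y <= x].
Proof.
have /asboolP xC := valP x; apply: sub_countable xC.
apply: (card_le_trans (B := val @` [set y : omega1 | y <= x])).
  by have /card_eqPle[] := inj_card_eq (in2W val_inj : {in [set y | y <= x] &, injective val}).
by apply: subset_card_le => _ [y yx <-].
Qed.

Lemma omega1_uncountable : ~ countable [set: omega1].
Proof.
move=> oC; pose W := [set x | countable [set y | wo_le y x]].
have WC : countable W.
  apply: (sub_countable _ oC).
  apply: (card_le_trans (B := val @` [set: omega1])); last exact: card_image_le.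
  apply: subset_card_le => x Wx.
  by exists (exist _ x (asboolT Wx)).
have [WT|] := pselect (W = setT).
  move: WC; rewrite WT => /countable_injP[f finj].
  pose D := [set n | exists2 X : set nat, f X = n & ~ X n].
  have nD : ~ D (f D).
    by move=> DD; have [X /finj -> //] := DD; rewrite ?inE.
  by apply: (nD); exists D.
move=> WnT; have [|z [[zA zm] _]] := wo_leP (A := [pred t | `[< ~ W t >]]).
  apply: contrapT => nW; apply: WnT; apply/seteqP; split=> // x _.
  by apply: contrapT => nWx; apply: nW; exists x; exact/asboolP.
move: zA => /asboolP; apply.
apply: (sub_countable (B := W `|` [set z])); last first.
  by rewrite -bigcup2E; apply: bigcup_countable => //= -[|[|n]] _ //=.
apply: subset_card_le => y /= yz; have [->|yNz] := eqVneq y z; [by right|left].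
apply: contrapT => nWy; move/eqP: yNz; apply; apply: wo_le_anti.
by rewrite yz zm//; exact/asboolP.
Qed.

(* For well-orders X (with the order of T) and U: the order type of X is an
   initial segment of, i.e. an ordinal at most, the order type of U. *)
Definition otype_le d d' (T : orderType d) (X : set T) (U : orderType d') :=
  exists f : T -> U, {in X &, {mono f : x y / x <= y}} /\
    forall u v : U, (f @` X) v -> u <= v -> (f @` X) u.

(* The ordinal alpha is given by a well-ordered type of that order type. *)
Definition ordinal_ultrafilter d (alpha : orderType d) (u : set_system nat) :=
  UltraFilter u /\
  forall F : nat -> omega1, exists2 A, u A & otype_le (F @` A) alpha.

(* omega^2 = omega * omega is the order type of the lexicographic product. *)
Definition omega_squared := (nat *l nat)%type.

Definition nowhere_dense (T : topologicalType) (S : set T) :=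
  (closure S)^° = set0.

Definition nowhere_dense_ultrafilter (u : set_system nat) :=
  UltraFilter u /\
  forall F : nat -> cantor_space, exists2 A, u A & nowhere_dense (F @` A).

Section Forcing.
Context d (P : porderType d).

Definition centered (C : set P) :=
  forall F : set P, finite_set F -> F `<=` C -> lbound F !=set0.

Definition sigma_centered :=
  exists2 C : nat -> set P, (forall n, centered (C n)) & \bigcup_n C n = setT.

Definition order_dense (D : set P) := forall p : P, exists2 q, D q & q <= p.

Definition order_filter (G : set P) :=
  [/\ G !=set0,
      (forall p q, G p -> p <= q -> G q) &
      (forall p q, G p -> G q -> exists r, [/\ G r, r <= p & r <= q])].

End Forcing.

(* The nonemptiness of P, implicit in forcing terminology, is needed: the
   empty order has no nonempty filter. *)
Definition MA_sigma_centered :=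
  forall d (P : porderType d), [set: P] !=set0 -> sigma_centered P ->
  forall DD : set (set P),
    (DD #<= [set: set nat]) && ~~ ([set: set nat] #<= DD) ->
    (forall D, DD D -> order_dense D) ->
  exists2 G : set P, order_filter G & forall D, DD D -> G `&` D !=set0.

(* Main.v *)
(* Identify nat with the finite binary strings, and call X somewhere dense if it
   is dense in the cone above some string v.  By recursion along a well-order
   of type the continuum we choose sets A_x such that all finite intersections
   are somewhere dense and the x-th map nat -> omega_1 has image of type at
   most omega^2 on A_x.  The A_x and the complements of the sets that are not
   somewhere dense then generate a proper filter, and any ultrafilter extending
   it works, the failing map being the embedding of the strings into the Cantor
   space.

   One step: given G and a filter base of fewer than continuum many somewhere
   dense sets F, take for each F the least initial segment G < gamma for which
   F & {G < gamma} is dense in some cone v.  By minimality F & {b <= G < gamma}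
   is still dense in v for every b < gamma.  A first use of Martin's Axiom gives
   a sequence of pairs (v_k, gamma_k) such that every F has this property at
   almost all k; pass to a subsequence with gamma_k nondecreasing.  A second use
   gives A, a union of sets A_k with G < gamma_k on A_k, which meets each such F
   densely in v_k, and such that, for each b, only finitely many points q of the
   A_k with b < gamma_k satisfy G q < b.  Cutting omega_1 at the gamma_k splits
   G(A) into omega many blocks of type at most omega.

   Finite intersections of the filter base are indexed by lists, so one needs
   that fewer than continuum many elements give fewer than continuum many lists.
   Under Martin's Axiom this follows from a Koenig-style diagonal argument,
   since almost disjoint coding yields 2^kappa <= 2^omega if kappa < 2^omega. *)
Require Import Defs.
From HB Require Import structures.
From mathcomp Require Import finmap.
From mathcomp Require Import all_boot all_order.
From mathcomp Require Import boolp classical_sets cardinality wochoice.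
From mathcomp Require Import filter topology cantor.

Set Implicit Arguments.
Unset Strict Implicit.
Unset Printing Implicit Defensive.

Import Order.TTheory.
Local Open Scope classical_set_scope.
Local Open Scope card_scope.
Local Open Scope order_scope.

(** * Well-orders and order types at most omega^2 *)

Lemma well_order_argmin d (U : orderType d) (T : Type) (P : T -> Prop)
    (g : T -> U) :
  well_order (<=%O : rel U) -> (exists x, P x) ->
  exists2 x, P x & forall y, P y -> g x <= g y.
Proof.
move=> wo [x Px].
have [|z [[/asboolP[y Py <-] zm] _]] :=
  wo [pred t | `[< exists2 x, P x & g x = t >]].
  by exists (g x); apply/asboolP; exists x.
by exists y => // t Pt; apply: zm; apply/asboolP; exists t.
Qed.

Lemma well_order_lt_wf d (U : orderType d) :
  well_order (<=%O : rel U) -> well_founded (fun x y : U => x < y).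
Proof.
move=> wo x; apply: contrapT => nx.
have [y ny ym] :=
  @well_order_argmin _ U U (fun z => ~ Acc _ z) id wo (ex_intro _ x nx).
apply: ny; constructor => z zy; apply: contrapT => nz.
by have := ym z nz; rewrite leNgt zy.
Qed.

Lemma omega_squared_wo : well_order (<=%O : rel omega_squared).
Proof.
apply: antisymmetric_well_order; first exact: le_anti.
move=> A [[a b] Aab].
have ex1 : exists n, `[< exists m, (n, m) \in A >].
  by exists a; apply/asboolP; exists b.
case: (ex_minnP ex1) => n /asboolP exm nmin.
case: (ex_minnP exm) => m nmA mmin; exists (n, m); split=> // -[p q] pqA.
rewrite lexi_pair; have np : (n <= p)%N by apply: nmin; apply/asboolP; exists q.
rewrite leEnat np /=; apply/implyP => pn; apply: mmin.
by have -> : n = p by apply/eqP; rewrite eqn_leq np.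
Qed.

(* Mostowski collapse of the image of the embedding. *)
Lemma otype_le_embed d d' (T : orderType d) (U : orderType d') (X : set T)
    (h : T -> U) : well_order (<=%O : rel U) ->
  {in X &, {homo h : x y / x < y}} -> otype_le X U.
Proof.
move=> woU hX; have wf := well_order_lt_wf woU; pose S := h @` X.
have step (s : U) (c : forall t, t < s -> U) : exists m : U,
    (exists m0, ~ exists2 t, S t & exists ts : t < s, c t ts = m0) ->
    (~ exists2 t, S t & exists ts : t < s, c t ts = m) /\
    forall m', ~ (exists2 t, S t & exists ts : t < s, c t ts = m') -> m <= m'.
  have [ex|nex] := pselect (exists m0,
      ~ exists2 t, S t & exists ts : t < s, c t ts = m0).
    have [m mP mmin] := @well_order_argmin _ U U
      (fun m => ~ exists2 t, S t & exists ts : t < s, c t ts = m) id woU ex.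
    by exists m.
  by exists s.
pose F s c := projT1 (cid (step s c)).
pose c : U -> U := Fix wf (fun _ => U) F.
have cE s : c s = F s (fun t _ => c t).
  rewrite /c Fix_eq // => x f g fg; congr (F x _).
  apply/functional_extensionality_dep => y.
  exact/functional_extensionality_dep.
have cmin s : (exists m0, ~ exists2 t, S t & t < s /\ c t = m0) ->
    (~ exists2 t, S t & t < s /\ c t = c s) /\
    forall m', ~ (exists2 t, S t & t < s /\ c t = m') -> c s <= m'.
  move=> [m0 m0P]; have := projT2 (cid (step s (fun t _ => c t))).
  rewrite -/(F s _) -cE => -[|nc cm].
    by exists m0 => -[t St [ts ctm]]; apply: m0P; exists t.
  split=> [[t St [ts ct]]|m' m'P].
    by apply: nc; exists t => //; exists ts.
  by apply: cm => -[t St [ts ct]]; apply: m'P; exists t.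
(* While [c t <= t] below [s], the value [s] itself is still free. By induction [c s <= s], so the
   recursion never runs out of values. *)
have nS s : (forall t, t < s -> c t <= t) ->
    ~ exists2 t, S t & t < s /\ c t = s.
  by move=> cle [t St [ts cts]]; have := cle t ts; rewrite cts leNgt ts.
have cle s : c s <= s.
  elim/(well_founded_ind wf): s => s /nS nSs.
  by have [|_] := cmin s; [exists s|exact].
have {nS}cP s : (~ exists2 t, S t & t < s /\ c t = c s) /\
    forall m', ~ (exists2 t, S t & t < s /\ c t = m') -> c s <= m'.
  by apply: cmin; exists s; apply: nS => t _; exact: cle.
have cmono s t : S s -> S t -> s < t -> c s < c t.
  move=> Ss St st; have [nct _] := cP t; have [_ cs] := cP s.
  rewrite lt_neqAle; apply/andP; split.
    by apply/eqP => cst; apply: nct; exists s.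
  apply: cs => -[r Sr [rs cr]]; apply: nct; exists r => //; split=> //.
  exact: lt_trans st.
exists (c \o h); split.
  apply: le_mono_in => x y Xx Xy xy /=; apply: cmono; last exact: hX.
    by exists x => //; exact: set_mem.
  by exists y => //; exact: set_mem.
move=> u v [x Xx <-] uv.
have [->|uneq] := eqVneq u (c (h x)); first by exists x.
have ult : u < c (h x) by rewrite lt_neqAle uneq uv.
have [_ cm] := cP (h x).
have : ~ ~ exists2 t, S t & t < h x /\ c t = u.
  by move=> /cm; rewrite leNgt ult.
by move=> /contrapT[_ [y Xy <-] [_ <-]]; exists y.
Qed.

(** Sending [b] to its block index and the number of earlier points in its block is strictly
    increasing into the lexicographic product. *)
Lemma otype_le_blocks d (T : orderType d) (X : set T) (i : T -> nat) :
  {in X &, {homo i : x y / x <= y >-> (x <= y)%N}} ->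
  (forall b, X b -> finite_set [set x | [/\ X x, x < b & i x = i b]]) ->
  otype_le X omega_squared.
Proof.
move=> ile fin.
pose B b := [set x | [/\ X x, x < b & i x = i b]].
apply: (@otype_le_embed _ _ _ _ _
  (fun b => (i b, #|` fset_set (B b)|%fset) : omega_squared)).
  exact: omega_squared_wo.
move=> b c Xb Xc bc.
have ibc : (i b <= i c)%N by apply: ile => //; exact: ltW.
rewrite ltxi_pair leEnat ibc /=; apply/implyP => icb.
have {icb}ibc : i b = i c by apply/eqP; rewrite eqn_leq ibc.
rewrite ltEnat /=; apply: fproper_ltn_card; rewrite fproperE; apply/andP; split.
  apply/fsubsetP.
  move=> x; rewrite !in_fset_set; [|exact/fin/set_mem..].
  move=> /set_mem[Xx xb ix]; apply: mem_set; split=> //.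
    exact: lt_trans bc.
  by rewrite ix.
apply/fsubsetPn; exists b.
  rewrite in_fset_set; last exact/fin/set_mem.
  by apply: mem_set; split=> //; exact: set_mem.
rewrite in_fset_set; last exact/fin/set_mem.
by apply/negP => /set_mem[_]; rewrite ltxx.
Qed.

(** * Sets with at least continuum many elements *)

Definition large (T : Type) (X : set T) :=
  exists h : T -> set nat, forall Z, exists2 x, X x & h x = Z.

Lemma largeP (T : Type) (X : set T) : [set: set nat] #<= X <-> large X.
Proof.
split=> [/pcard_surjP[h hs]|[h hs]].
  by exists h => Z; have [x] := hs Z I; exists x.
apply/pcard_surjP; exists h => Z _; have [x] := hs Z; by exists x.
Qed.

Lemma sub_large (T : Type) (X Y : set T) : X `<=` Y -> large X -> large Y.
Proof. by move=> XY [h hs]; exists h => Z; have [x /XY] := hs Z; exists x. Qed.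

Lemma large_image (T U : Type) (f : T -> U) (X : set T) :
  large (f @` X) -> large X.
Proof.
move=> [h hs]; exists (h \o f) => Z; have [_ [x Xx <-] <-] := hs Z.
by exists x.
Qed.

Lemma large_surj (K : countType) (T : Type) (X : set T) : large X ->
  exists h : T -> nat -> set K, forall Z, exists2 x, X x & h x = Z.
Proof.
move=> [h hs].
exists (fun x n => [set k : K | h x (pickle (n, pickle k))]) => Z.
have [x Xx hx] :=
  hs [set m | exists n (k : K), m = pickle (n, pickle k) /\ Z n k].
exists x => //; apply/funext => n; apply/seteqP; split=> k; rewrite /= hx /=.
  move=> [n' [k' [+ Znk]]] => /(pcan_inj pickleK)[-> +].
  by move=> /(pcan_inj pickleK) ->.
by move=> Znk; exists n, k.
Qed.

(** Koenig's argument: if for each [n] the [n]-th terms of the sequences indexed by [X n] omit some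
    [y n], then the sequence [y] has no index in the union. *)
Lemma large_bigcup (T : Type) (X : nat -> set T) :
  large (\bigcup_n X n) -> exists n, large (X n).
Proof.
move=> /(@large_surj nat)[h hs]; apply: contrapT => /forallNP nbX.
have yP n : exists y, forall x, X n x -> h x n <> y.
  apply: contrapT => /forallNP hn; apply: (nbX n); exists (h^~ n) => Z.
  by have /existsNP[x /not_implyP[Xx /contrapT]] := hn Z; exists x.
have [y yN] := choice yP.
by have [x [n _ /yN] /[swap] ->] := hs y.
Qed.

Lemma set1_not_large (T : Type) (x : T) : ~ large [set x].
Proof.
move=> [h hs]; have [_ -> h0] := hs set0; have [_ -> hT] := hs setT.
by have : [set: nat] 0 by []; rewrite -hT h0.
Qed.

Lemma countable_not_large (T : Type) (X : set T) : countable X -> ~ large X.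
Proof.
move=> cX bX; have bN : large [set: nat].
  by apply/largeP; apply: card_le_trans cX; exact/largeP.
have : large (\bigcup_(n in [set: nat]) [set n]).
  by apply: (sub_large _ bN) => n; exists n.
by move=> /large_bigcup[n bn]; exact: set1_not_large bn.
Qed.

Lemma range_not_large (K : countType) (T : Type) (f : K -> T) :
  ~ large (range f).
Proof.
by move=> /large_image; apply: countable_not_large; exact: countableP.
Qed.

(** * Martin's Axiom in the form of Booth's lemma *)

Section BoothOrder.
Variables (C : countType) (R : set (set C)).

(** A condition is a finite part of the set to be built, with finitely many promises: points added
    later must lie in every promised member of [R]. *)
Definition booth_cond := {p : set C * set (set C) |
  `[< [/\ finite_set p.1, finite_set p.2 & p.2 `<=` R] >]}.

HB.instance Definition _ := Choice.on booth_cond.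

Definition booth_le : rel booth_cond := fun q p =>
  `[< [/\ (val p).1 `<=` (val q).1, (val p).2 `<=` (val q).2 &
       forall x r, (val q).1 x -> (val p).2 r -> (val p).1 x \/ r x] >].

Lemma booth_le_refl : reflexive booth_le.
Proof. by move=> p; apply/asboolP; split=> // x r; left. Qed.

Lemma booth_le_anti : antisymmetric booth_le.
Proof.
move=> p q /andP[/asboolP[qp1 qp2 _] /asboolP[pq1 pq2 _]].
apply: val_inj; rewrite [val p]surjective_pairing [val q]surjective_pairing.
by congr pair; apply/seteqP; split.
Qed.

Lemma booth_le_trans : transitive booth_le.
Proof.
move=> q p r /asboolP[qp1 qp2 qp] /asboolP[rq1 rq2 rq]; apply/asboolP; split.
- exact: subset_trans qp1.
- exact: subset_trans qp2.
- move=> x s px rs; have [qx|] := qp x s px (rq2 _ rs); last by right.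
  exact: rq.
Qed.

Fact booth_display : Order.disp_t. Proof. exact: Order.Disp tt tt. Qed.

HB.instance Definition _ := Order.Le_isPOrder.Build booth_display booth_cond
  booth_le_refl booth_le_anti booth_le_trans.

Lemma booth_leP (p q : booth_cond) : reflect
  [/\ (val q).1 `<=` (val p).1, (val q).2 `<=` (val p).2 &
       forall x r, (val p).1 x -> (val q).2 r -> (val q).1 x \/ r x]
  (p <= q)%O.
Proof. exact: asboolP. Qed.

Lemma booth_valP (p : booth_cond) :
  [/\ finite_set (val p).1, finite_set (val p).2 & (val p).2 `<=` R].
Proof. exact/asboolP/(valP p). Qed.

Definition mk_booth (p : set C * set (set C))
    (pP : [/\ finite_set p.1, finite_set p.2 & p.2 `<=` R]) : booth_cond :=
  exist _ p (asboolT pP).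

(* Conditions with the same first component are compatible, and there are
   only countably many possible first components. *)
Lemma booth_sigma_centered : sigma_centered booth_cond.
Proof.
exists (fun n => [set p : booth_cond |
    (val p).1 = [set` odflt [::] (unpickle n : option (seq C))]]); last first.
  apply/seteqP; split=> // p _; have [/finite_seqP[s sE] _ _] := booth_valP p.
  by exists (pickle s) => //; rewrite /mkset pickleK.
move=> n F finF FC.
pose t : set C := [set` odflt [::] (unpickle n : option (seq C))].
have pP : [/\ finite_set (t, \bigcup_(p in F) (val p).2).1,
   finite_set (t, \bigcup_(p in F) (val p).2).2 &
   (t, \bigcup_(p in F) (val p).2).2 `<=` R].
  split=> /=; first exact: finite_seq.
    by apply: bigcup_finite => // p _; have [] := booth_valP p.
  by move=> r [p _]; have [_ _] := booth_valP p; exact.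
exists (mk_booth pP) => p Fp; apply/booth_leP; split=> /=.
- by rewrite (FC _ Fp).
- by move=> r pr; exists p.
- by move=> x r tx _; left; rewrite (FC _ Fp).
Qed.

End BoothOrder.

Lemma set_count_card_le (C : countType) (X : set (set C)) :
  X #<= [set: set nat].
Proof.
pose F (Z : set nat) := [set c : C | Z (pickle c)].
apply: (card_le_trans (B := F @` setT)).
  apply: subset_card_le => Y _; exists (pickle @` Y) => //.
  apply/seteqP; split=> c /=; first by move=> [c' Yc' /(pcan_inj pickleK) <-].
  by move=> Yc; exists c.
exact: card_image_le.
Qed.

(** Let [A] be the union of the finite parts over a generic filter. Once a condition promises [r],
    only points of its own finite part can lie outside [r]. Meeting [e] is dense, since [e] has a
    point in all promised sets. *)
Lemma MA_booth (C : countType) (R E : set (set C)) :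
  MA_sigma_centered -> ~ large R -> ~ large E ->
  (forall a e, finite_set a -> a `<=` R -> E e ->
    (e `&` \bigcap_(r in a) r) !=set0) ->
  exists A : set C, (forall r, R r -> finite_set (A `\` r)) /\
                    (forall e, E e -> A `&` e !=set0).
Proof.
move=> MA nR nE RE; pose P := booth_cond R.
pose D (X : set C) := [set p : P | (R X -> (val p).2 X) /\
                                   (E X -> (val p).1 `&` X !=set0)].
have [|||G [[p0 Gp0] _ Gdir] GD] :=
  MA _ P _ (@booth_sigma_centered _ R) (D @` (R `|` E)).
- have p0P : [/\ finite_set (set0 : set C, set0 : set (set C)).1,
    finite_set (set0 : set C, set0 : set (set C)).2 &
    (set0 : set C, set0 : set (set C)).2 `<=` R] by split=> //=.
  by exists (mk_booth p0P).
- apply/andP; split.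
    apply: card_le_trans (set_count_card_le (R `|` E)); exact: card_image_le.
  apply/negP => /largeP /large_image.
  rewrite -bigcup2E => /large_bigcup[[|[|n]]] //=.
  by move=> [h hs]; have [] := hs set0.
- move=> _ [X _ <-] p.
  have [pf1 pf2 pR] := booth_valP p.
  have [t [tf pt tE tp]] : exists t, [/\ finite_set t, (val p).1 `<=` t,
      E X -> t `&` X !=set0 &
      forall x r, t x -> (val p).2 r -> (val p).1 x \/ r x].
    have [EX|nEX] := pselect (E X); last first.
      by exists (val p).1; split=> // x r; left.
    have [x [Xx xr]] := RE _ _ pf2 pR EX.
    exists ((val p).1 `|` [set x]); split.
    - by rewrite finite_setU.
    - by move=> y; left.
    - by exists x; split=> //; right.
    - by move=> y r [|->]; [left|right; exact: xr].
  have qP : [/\ finite_set (t, (val p).2 `|` ([set X] `&` R)).1,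
      finite_set (t, (val p).2 `|` ([set X] `&` R)).2 &
      (t, (val p).2 `|` ([set X] `&` R)).2 `<=` R].
    split=> //=; last by move=> r [/pR|[]].
    by rewrite finite_setU; split=> //; exact: finite_setIl.
  exists (mk_booth qP); first by split=> // RX; right.
  by apply/booth_leP; split=> //= r; left.
exists (\bigcup_(p in G) (val p).1); split=> [r Rr|e Ee].
  have [|p [Gp [/(_ Rr) pr _]]] := GD (D r); first by exists r => //; left.
  have [pf _ _] := booth_valP p; apply: sub_finite_set pf => x [[q Gq qx] nrx].
  have [s [_ /booth_leP[_ _ sp] /booth_leP[sq _ _]]] := Gdir _ _ Gp Gq.
  by have [] := sp x r (sq _ qx) pr.
have [|p [Gp [_ /(_ Ee)[x [px ex]]]]] := GD (D e).
  by exists e => //; right.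
by exists x; split=> //; exists p.
Qed.

(** * Almost disjoint coding and the number of finite lists *)

Lemma finite_eventually (T : choiceType) (a : set T) (P : T -> nat -> Prop) :
  finite_set a -> (forall r, a r -> exists N, forall m, N <= m -> P r m)%N ->
  exists N, forall m r, (N <= m)%N -> a r -> P r m.
Proof.
move=> /finite_seqP[s ->]; elim: s => [|r s IH] aP; first by exists 0.
have [|N NP] := IH; first by move=> t ts; apply: aP; rewrite /= inE ts orbT.
have [|M MP] := aP r; first by rewrite /= inE eqxx.
exists (maxn N M) => m t; rewrite geq_max => /andP[Nm Mm].
by rewrite /= inE => /orP[/eqP->|ts]; [exact: MP|exact: NP].
Qed.

Definition branch (X : set nat) : set (seq bool) :=
  range (mkseq (fun i => `[< X i >])).

Lemma branch_disjoint (X Y : set nat) : X <> Y ->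
  exists N, forall m, (N <= m)%N -> ~ branch Y (mkseq (fun i => `[< X i >]) m).
Proof.
move=> XY; have [i Xi] : exists i, `[< X i >] != `[< Y i >].
  apply: contrapT => /forallNP XYi; apply: XY; apply/funext => i; apply/propext.
  by apply: asbool_eq_equiv; apply/eqP/negPn/negP; exact: XYi.
exists i.+1 => m im [n _ Ynm].
have nm : n = m by move/(congr1 size): Ynm; rewrite !size_mkseq.
move/eqP: Xi; apply.
by move/(congr1 (fun s => nth true s i)): Ynm; rewrite nm !nth_mkseq.
Qed.

(** Distinct branches of the binary tree are almost disjoint. Booth's lemma therefore yields a set
    almost disjoint from the branches of [Y] that meets every tail of the other branches of [I]. *)
Lemma MA_subset_code (I Y : set (set nat)) :
  MA_sigma_centered -> ~ large I -> Y `<=` I ->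
  exists Z : set (seq bool), forall X, I X ->
    finite_set (Z `&` branch X) <-> Y X.
Proof.
move=> MA nI YI.
pose R := (fun X => ~` branch X) @` Y.
pose e n X := branch X `&` [set s : seq bool | (n <= size s)%N].
have [|||A [AR AE]] := @MA_booth _ R (\bigcup_n (e n @` (I `\` Y))) MA.
- by move=> /large_image bY; apply: nI; exact: sub_large bY.
- move=> /large_bigcup[n /large_image bY].
  by apply: nI; apply: sub_large bY => X [].
- move=> a _ af aR [n _ [X [IX nYX] <-]].
  pose u m := mkseq (fun i => `[< X i >]) m.
  have [|N NP] := finite_eventually (P := fun r m => r (u m)) af.
    move=> _ /aR[X' YX' <-]; apply: branch_disjoint => XX'.
    by apply: nYX; rewrite XX'.
  exists (u (maxn N n)); split; last by move=> r; apply: NP; rewrite leq_maxl.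
  by split; [exists (maxn N n)|rewrite /= size_mkseq leq_maxr].
exists A => X IX; split=> [|YX]; last first.
  by rewrite -(setCK (branch X)) -setDE; apply: AR; exists X.
move=> fA; apply: contrapT => nYX.
have [|N NP] := finite_eventually (P := fun s m => (size s < m)%N) fA.
  by move=> s _; exists (size s).+1.
have [|s [As [bs Ns]]] := AE (e N X); first by exists N => //; exists X.
by have := NP N s (leqnn _) (conj As bs); rewrite ltnNge Ns.
Qed.

(** For each [X] pick [y X] different from all values decoded at [X] from the indices [(X, x)] with
    [x] in [J]. Coding [y] on [I] into one sequence [Z] gives a contradiction at the index of
    [Z]. *)
Lemma MA_not_largeX (I : set (set nat)) (T : Type) (J : set T) :
  MA_sigma_centered -> ~ large I -> ~ large J -> ~ large (I `*` J).
Proof.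
move=> MA nI nJ /(@large_surj (seq bool))[h hs].
pose d Z X : set nat := [set n | finite_set (Z n `&` branch X)].
have yP X : exists y, forall x, J x -> d (h (X, x)) X <> y.
  apply: contrapT => /forallNP hn; apply: nJ.
  exists (fun x => d (h (X, x)) X) => y.
  by have /existsNP[x /not_implyP[Jx /contrapT]] := hn y; exists x.
have [y yN] := choice yP.
have ZP n :=
  @MA_subset_code I (fun X => I X /\ y X n) MA nI (fun _ => @proj1 _ _).
have [Z {}ZP] := choice ZP.
have [[X x] [/= IX Jx] hZ] := hs Z.
apply: (yN X x Jx); rewrite hZ; apply/seteqP; split=> n.
  by move=> /(ZP n X IX)[].
by move=> yn; apply/(ZP n X IX).
Qed.

(** Products handle each fixed length, and Koenig's argument joins the countably many lengths. *)
Lemma MA_not_large_seq (I : set (set nat)) : MA_sigma_centered -> ~ large I ->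
  ~ large [set s : seq (set nat) | forall X, X \in s -> I X].
Proof.
move=> MA nI bs.
have : large (\bigcup_n [set s | size s = n /\ forall X, X \in s -> I X]).
  by apply: sub_large bs => s; exists (size s).
move=> /large_bigcup[n]; elim: n => [|n IH].
  move=> bn; apply: (@set1_not_large _ ([::] : seq (set nat))).
  by apply: sub_large bn => s [/size0nil].
move=> bn; apply: (@MA_not_largeX I _ _ MA nI IH).
apply: (@large_image _ _ (fun p => p.1 :: p.2)).
apply: sub_large bn => -[[]//|X s [[sn] sI]].
exists (X, s) => //=; split; first by apply: sI; rewrite inE eqxx.
by split=> // Y Ys; apply: sI; rewrite inE Ys orbT.
Qed.

Lemma finite_sub_image_seq (T U : choiceType) (F : T -> U) (D : set T)
    (a : set U) : finite_set a -> a `<=` F @` D ->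
  exists2 l : seq T, (forall x, x \in l -> D x) &
    forall y, a y -> exists2 x, x \in l & y = F x.
Proof.
move=> /finite_seqP[r ->]; elim: r => [_|y r IH rF]; first by exists [::].
have [|l lD lr] := IH; first by move=> z zr; apply: rF; rewrite /= inE zr orbT.
have [|x Dx Fx] := rF y; first by rewrite /= inE eqxx.
exists (x :: l) => z; rewrite /= inE => /orP[]; [by move=> /eqP->|exact: lD| |].
  by move=> /eqP->; exists x; rewrite // inE eqxx.
by move=> /lr[w wl ->]; exists w; rewrite // inE wl orbT.
Qed.

(** * Sequences in omega_1 *)

Lemma omega1_strict_bound (G : nat -> omega1) : exists t, forall q, G q < t.
Proof.
apply: contrapT => /forallNP nt; apply: omega1_uncountable.
have : countable (\bigcup_q [set y | y <= G q]).
  by apply: bigcup_countable => // q _; exact: omega1_countable_segment.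
apply: sub_countable; apply: subset_card_le => t _.
by have /existsNP[q /negP] := nt t; rewrite -leNgt; exists q.
Qed.

(** [next k] is a place where [u] is least on the tail from [k]; minima over shrinking tails are
    nondecreasing. *)
Lemma omega1_nondecreasing_subsequence (u : nat -> omega1) :
  exists s : nat -> nat, (forall m, (m <= s m)%N) /\
    forall m n, (m <= n)%N -> u (s m) <= u (s n).
Proof.
have next_ex k : exists n, (k <= n)%N /\ forall m, (k <= m)%N -> u n <= u m.
  have [|n kn nmin] :=
    @well_order_argmin _ _ nat (fun n => (k <= n)%N) u omega1_wo.
    by exists k.
  by exists n.
have [next nextP] := choice next_ex.
pose k m := iter m (fun i => (next i).+1) 0%N.
have kS m : (k m < k m.+1)%N by rewrite /= ltnS; have [] := nextP (k m).
have kle m : (m <= k m)%N by elim: m => // m IH; exact: leq_ltn_trans (kS m).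
exists (next \o k); split=> [m|m n mn] /=.
  by have [+ _] := nextP (k m); exact: leq_trans.
have [_ ] := nextP (k m); apply; have [+ _] := nextP (k n).
by apply: leq_trans; apply: (homo_leq leqnn leq_trans _ mn) => i; exact: ltnW.
Qed.

(** * Somewhere dense sets of binary strings *)

Definition str (q : nat) : seq bool := odflt [::] (unpickle q).

Definition dense_at (X : set nat) (v : seq bool) :=
  forall w, prefix v w -> exists2 q, X q & prefix w (str q).

Definition somewhere_dense (X : set nat) := exists v, dense_at X v.

Lemma dense_atS X Y v : X `<=` Y -> dense_at X v -> dense_at Y v.
Proof. by move=> XY Xv w /Xv[q /XY]; exists q. Qed.

Lemma dense_at_prefix X v w : prefix v w -> dense_at X v -> dense_at X w.
Proof. by move=> vw Xv x wx; apply: Xv; exact: prefix_trans wx. Qed.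

Lemma somewhere_denseS X Y : X `<=` Y -> somewhere_dense X -> somewhere_dense Y.
Proof. by move=> XY [v /(dense_atS XY)]; exists v. Qed.

Lemma somewhere_denseT : somewhere_dense setT.
Proof.
by exists [::] => w _; exists (pickle w); rewrite // /str pickleK prefix_refl.
Qed.

(** Every cone contains a smaller cone free of [Y], and below [v] the set [X] has a point there.
    Hence the sets that are not somewhere dense form an ideal. *)
Lemma dense_atD X Y v : dense_at X v -> ~ somewhere_dense Y ->
  dense_at (X `\` Y) v.
Proof.
move=> Xv /forallNP nY w vw.
have /existsNP[x /not_implyP[wx /forall2NP nYx]] := nY w.
have [q Xq xq] := Xv x (prefix_trans vw wx).
exists q; last exact: prefix_trans xq.
by split=> // Yq; case: (nYx q).
Qed.

Lemma somewhere_denseU X Y :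
  somewhere_dense (X `|` Y) -> somewhere_dense X \/ somewhere_dense Y.
Proof.
move=> [v Uv]; have [sY|nY] := pselect (somewhere_dense Y); first by right.
left; exists v; apply: dense_atS (dense_atD Uv nY).
by move=> q [[]].
Qed.

Lemma somewhere_dense0 : ~ somewhere_dense set0.
Proof. by move=> [v /(_ v (prefix_refl v))[]]. Qed.

Lemma somewhere_dense_bigcup (T : choiceType) (s : seq T) (Y : T -> set nat) :
  (forall j, j \in s -> ~ somewhere_dense (Y j)) ->
  ~ somewhere_dense (\bigcup_(j in [set` s]) Y j).
Proof.
rewrite bigcup_seq; elim: s => [_|j s IH sY].
  by rewrite big_nil; exact: somewhere_dense0.
rewrite big_cons => /somewhere_denseU[|].
  by apply: sY; rewrite inE eqxx.
by apply: IH => k ks; apply: sY; rewrite inE ks orbT.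
Qed.

Definition cap (f : set nat -> set nat) (s : seq (set nat)) : set nat :=
  [set q | forall X, X \in s -> f X q].

Lemma cap_cat f s t : cap f (s ++ t) = cap f s `&` cap f t.
Proof.
apply/seteqP; split=> [q st|q [sq tq] X]; last first.
  by rewrite mem_cat => /orP[/sq|/tq].
by split=> X Xs; apply: st; rewrite mem_cat Xs ?orbT.
Qed.

(** * One step of the recursion *)

Section Stage.
Variables (G : nat -> omega1) (t : omega1).
Hypothesis Gt : forall q, G q < t.

(* Codes of initial segments of the range of [G]: [Some j] stands for
   [{q | G q < G j}] and [None] for the whole of [nat]. *)
Definition code_val (c : option nat) : omega1 := if c is Some j then G j else t.

(** The lower bounds are indexed by [nat] and imposed finitely many at a time, to match the finite
    sets of promises in Booth's lemma. *)
Definition cofinally_dense (X : set nat) (p : seq bool * option nat) :=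
  forall a : seq nat, dense_at [set q | [/\ X q, G q < code_val p.2 &
    forall j, j \in a -> G j < code_val p.2 -> G j <= G q]] p.1.

Lemma cofinally_denseS X Y p : X `<=` Y ->
  cofinally_dense X p -> cofinally_dense Y p.
Proof.
by move=> XY Xp a; apply: dense_atS (Xp a) => q [/XY Yq Gq aq]; split.
Qed.

Lemma cofinally_dense_prefix X v w c : prefix v w ->
  cofinally_dense X (v, c) -> cofinally_dense X (w, c).
Proof. by move=> vw Xv a; exact: dense_at_prefix (Xv a). Qed.

(** Take [code_val c] least. By minimality the points of [X] with value below a smaller [G j] are
    not somewhere dense, so finitely many such sets can be removed. *)
Lemma cofinally_dense_ex X : somewhere_dense X -> exists p, cofinally_dense X p.
Proof.
move=> sX; pose P c := somewhere_dense (X `&` [set q | G q < code_val c]).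
have [|c [v Xv] cmin] := @well_order_argmin _ _ _ P code_val omega1_wo.
  by exists None; apply: somewhere_denseS sX => q Xq; split=> //; exact: Gt.
exists (v, c) => a /=.
pose b := [seq j <- a | G j < code_val c].
have nb : ~ somewhere_dense
    (\bigcup_(j in [set` b]) (X `&` [set q | G q < G j])).
  apply: somewhere_dense_bigcup => j; rewrite mem_filter => /andP[jc _].
  by move=> /(cmin (Some j)); rewrite leNgt jc.
apply: dense_atS (dense_atD Xv nb) => q [[Xq qc] qb]; split=> // j ja jc.
rewrite leNgt; apply/negP => qj; apply: qb; exists j => //=.
by rewrite mem_filter jc.
Qed.

Variables (I : set (set nat)) (f : set nat -> set nat).
Hypothesis MA : MA_sigma_centered.
Hypothesis nI : ~ large I.
Let L := [set s : seq (set nat) | forall X, X \in s -> I X].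
Hypothesis fI : forall s, L s -> somewhere_dense (cap f s).

(** The sets [e m] force arbitrarily long strings into [A]. Since finitely many exceptional pairs
    have bounded length, [z m] eventually avoids them. *)
Lemma cofinally_dense_sequence : exists z : nat -> seq bool * option nat,
  (forall m n, (m <= n)%N -> code_val (z m).2 <= code_val (z n).2) /\
  forall s, L s -> exists k, cofinally_dense (cap f s) (z k).
Proof.
pose R := (fun s => cofinally_dense (cap f s)) @` L.
pose e m := [set p : seq bool * option nat | (m <= size p.1)%N].
have [|||A [AR Ae]] := @MA_booth _ R (range e) MA.
- by move=> bR; exact: MA_not_large_seq MA nI (large_image bR).
- exact: range_not_large.
- move=> a _ fa /(finite_sub_image_seq fa)[l lL al] [m _ <-].
  (* Concatenating the lists serves all promises with one pair; density survives lengthening the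
     string, so [v] can be padded to length at least [m]. *)
  have [|[v c] vc] := cofinally_dense_ex (X := cap f (flatten l)).
    by apply: fI => X /flattenP[s /lL]; exact.
  exists (v ++ nseq m true, c); split=> [|X /al[s sl ->]] /=.
    by rewrite /e /= size_cat size_nseq leq_addl.
  have {}vc := cofinally_dense_prefix (prefix_prefix v (nseq m true)) vc.
  apply: cofinally_denseS vc => q ql Y sY; apply: ql.
  by apply/flattenP; exists s.
have zex m : exists p, A p /\ (m <= size p.1)%N.
  by have [|p [Ap mp]] := Ae (e m); [exists m|exists p].
have [z zP] := choice zex.
have zev s : L s ->
    exists N, forall m, (N <= m)%N -> cofinally_dense (cap f s) (z m).
  move=> Ls.
  have Rs : R (cofinally_dense (cap f s)) by exists s.
  have [|N NP] :=
    finite_eventually (P := fun p m => (size p.1 < m)%N) (AR _ Rs).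
    by move=> p _; exists (size p.1).+1.
  exists N => m Nm; apply: contrapT => nzm; have [Az mz] := zP m.
  by have := NP m (z m) Nm (conj Az nzm); rewrite ltnNge mz.
have [s [s_ge s_mono]] :=
  omega1_nondecreasing_subsequence (fun m => code_val (z m).2).
exists (z \o s); split=> // l /zev[N Nz]; exists N.
apply: Nz; exact: s_ge.
Qed.

Lemma stage : exists A : set nat, otype_le (G @` A) omega_squared /\
  forall s, L s -> somewhere_dense (cap f s `&` A).
Proof.
have [z [z_mono zP]] := cofinally_dense_sequence.
pose g k := code_val (z k).2.
(* A pair [(k, q)] puts [q] into block [k]. As [B] lies in [r j] up to finitely many pairs, blocks
   with [G j < g k] have only finitely many points of value below [G j]. *)
pose r j := [set p : nat * nat | G j < g p.1 -> G j <= G p.2].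
pose e k w s := [set p : nat * nat |
  [/\ p.1 = k, cap f s p.2, G p.2 < g k & prefix w (str p.2)]].
pose Ls k := [set s | L s /\ cofinally_dense (cap f s) (z k)].
pose E := [set x | exists k w s, [/\ prefix (z k).1 w, Ls k s & x = e k w s]].
have [|||B [Br Be]] := @MA_booth _ (range r) E MA.
- exact: range_not_large.
- move=> bE.
  (* [E] is split along the countably many pairs [(k, w)] into images of sets of lists. *)
  pose E' n := if unpickle n is Some (k, w) then e k w @` Ls k else set0.
  have : large (\bigcup_n E' n).
    apply: sub_large bE => x [k [w [s [_ Ls_s ->]]]].
    by exists (pickle (k, w)) => //; rewrite /E' pickleK; exists s.
  move=> /large_bigcup[n]; rewrite /E'; case: unpickle => [[k w]|]; last first.
    by move=> [h hs]; have [] := hs set0.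
  move=> bLk; apply: (MA_not_large_seq MA nI).
  by apply: sub_large (large_image bLk) => s [].
- move=> a _ fa ar [k [w [s [zw [Ls_s /= zs] ->]]]].
  have [J _ aJ] := finite_sub_image_seq fa ar.
  have [q [sq qk qJ] wq] := zs J w zw.
  by exists (k, q); split=> // x /aJ[j jJ ->] /= jk; exact: qJ.
exists [set q | exists2 k, B (k, q) & G q < g k]; split; last first.
  move=> s Ls_s; have [k zk] := zP s Ls_s; exists (z k).1 => w zw.
  have [|[k' q] [Bkq [/= k'E sq qk wq]]] := Be (e k w s).
    by exists k, w, s.
  by rewrite k'E in Bkq; exists q => //; split; last exists k.
set S := G @` _.
have SP b : S b -> exists k, b < g k by move=> [q [k _ qk] <-]; exists k.
have iP b : exists n, S b -> b < g n /\ forall k, b < g k -> (n <= k)%N.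
  have [Sb|nSb] := pselect (S b); last by exists 0%N.
  have ex : exists k, `[< b < g k >].
    by have [k] := SP b Sb; exists k; exact/asboolP.
  case: (ex_minnP ex) => n /asboolP bn nmin; exists n => _; split=> // k bk.
  exact/nmin/asboolP.
have [i {}iP] := choice iP.
apply: (@otype_le_blocks _ _ _ i) => [b c /set_mem Sb /set_mem Sc bc|b Sb].
  have [_ bmin] := iP b Sb; have [ci _] := iP c Sc.
  by apply: bmin; exact: le_lt_trans ci.
have [j [_ _ _] jb] := Sb.
have fB : finite_set (B `\` r j) by apply: Br; exists j.
apply: sub_finite_set (finite_image (fun p => G p.2) fB).
move=> x [[q [k Bkq qk] <-] qb iq].
exists (k, q) => //; split=> //; rewrite /r /= jb => jk.
(* If [b < g k], the promise [r j] contradicts [G q < b]. If [g k <= b], then [i b = i (G q) <= k]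
   gives [g (i b) <= g k <= b], against the choice of [i b]. *)
have [|kb] := ltP b (g k); first by move=> /jk; rewrite leNgt qb.
have [bi _] := iP b Sb.
have [|_ qmin] := iP (G q); first by exists q => //; exists k.
have := z_mono (i b) k; rewrite -iq qmin // => /(_ isT).
by rewrite -/(g _) -/(g _) => /le_trans/(_ kb); rewrite leNgt iq bi.
Qed.

End Stage.

(** * Binary strings as points of the Cantor space *)

Definition cantor_pt (s : seq bool) : cantor_space := fun i => nth false s i.

Lemma cantor_cylinder_nbhs (x : cantor_space) (n : nat) :
  \forall y \near x, forall i, (i < n)%N -> y i = x i.
Proof.
have : \forall y \near x, forall i : 'I_n, y (val i) = x (val i).
  apply: (@filter_forall _ _
    (fun (i : 'I_n) (y : cantor_space) => y (val i) = x (val i))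
    _ (nbhs_filter x)) => i.
  have /(_ x) := @proj_continuous nat (fun=> bool) i.
  by move/(_ [set x i]); apply; exact: discrete_set1.
by apply: filterS => y yx i ni; exact: (yx (Ordinal ni)).
Qed.

Lemma cantor_cvg (u : nat -> cantor_space) (x : cantor_space) :
  (forall i, \forall m \near \oo, u m i = x i) -> u @ \oo --> x.
Proof.
move=> ux; apply/cvg_sup => i U [U' [[V oV <-] Vx] sub].
apply: filterS (ux i) => m umx; apply: sub.
by move: Vx; rewrite /preimage /= -[X in V X]umx.
Qed.

(** Each [y] in the cylinder of [v] is a limit of points from [A] that extend longer and longer
    initial segments of [y]. *)
Lemma dense_at_closure (A : set nat) (v : seq bool) : dense_at A v ->
  nbhs (cantor_pt v) (closure ((cantor_pt \o str) @` A)).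
Proof.
move=> Av; apply: filterS (cantor_cylinder_nbhs (cantor_pt v) (size v)) => y yv.
have vy m : prefix v (mkseq y (size v + m)).
  apply/prefixP; exists (mkseq (fun i => y (size v + i)%N) m).
  apply: (@eq_from_nth _ false); rewrite ?size_cat ?size_mkseq // => i im.
  rewrite nth_cat nth_mkseq //; case: ltnP => iv; first exact: yv.
  by rewrite nth_mkseq ?subnKC // ltn_subLR.
have qP m : exists q, A q /\ prefix (mkseq y (size v + m)) (str q).
  by have [q Aq qm] := Av _ (vy m); exists q.
have [q {}qP] := choice qP.
have : cantor_pt \o str \o q @ \oo --> (y : cantor_space).
  apply: cantor_cvg => i; exists i.+1 => // m /= im.
  have [_ /prefixP[r ->]] := qP m.
  rewrite /cantor_pt nth_cat size_mkseq.
  have im' : (i < size v + m)%N by rewrite (leq_trans im) // leq_addl.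
  by rewrite im' nth_mkseq.
move=> qy U /qy [N _ NU]; exists (cantor_pt (str (q N))); split.
  by exists (q N) => //; have [] := qP N.
by apply: NU => /=.
Qed.

Lemma somewhere_dense_cantor (A : set nat) : somewhere_dense A ->
  ~ nowhere_dense ((cantor_pt \o str) @` A).
Proof.
by move=> [v /dense_at_closure vA] A0; rewrite /nowhere_dense in A0;
  have : (closure ((cantor_pt \o str) @` A))^° (cantor_pt v); [|rewrite A0].
Qed.

(** * Recursion along a well-order of type the continuum *)

Definition wo_lt (x y : set nat) := wo_le x y /\ x <> y.

Lemma wo_le_ex_min (P : set nat -> Prop) : (exists x, P x) ->
  exists2 x, P x & forall y, P y -> wo_le x y.
Proof.
move=> [x Px]; have [|z [[/asboolP Pz zm] _]] := @wo_leP [pred t | `[< P t >]].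
  by exists x; apply/asboolP.
by exists z => // y Py; apply: zm; exact/asboolP.
Qed.

Lemma wo_lt_wf : well_founded wo_lt.
Proof.
move=> x; apply: contrapT => nx.
have [y ny ym] := @wo_le_ex_min (fun z => ~ Acc wo_lt z) (ex_intro _ x nx).
apply: ny; constructor => z [zy nzy]; apply: contrapT => nz.
by apply: nzy; apply: wo_le_anti; rewrite zy ym.
Qed.

(** Cut the well-order at the least point with continuum many predecessors, or keep all of it if
    there is none. *)
Lemma initial_continuum : exists W : set (set nat), large W /\
  forall x, W x -> ~ large [set y | W y /\ wo_lt y x].
Proof.
have [[x0 x0L]|/forallNP nL] := pselect (exists x, large [set y | wo_lt y x]).
  have [|x xL xmin] := @wo_le_ex_min (fun x => large [set y | wo_lt y x]).
    by exists x0.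
  exists [set y | wo_lt y x]; split=> // z [zx nzx] zL.
  apply: nzx; apply: wo_le_anti; rewrite zx xmin //.
  by apply: sub_large zL => y [].
exists setT; split; first by exists id => Z; exists Z.
by move=> x _ xL; apply: (nL x); apply: sub_large xL => y [].
Qed.

Lemma large_omega1_seq (T : Type) (W : set T) : large W ->
  exists H : T -> nat -> omega1, forall G, exists2 x, W x & H x = G.
Proof.
move=> /(@large_surj nat)[h hs].
have [w0 _] : [set: omega1] !=set0.
  apply/set0P/eqP => o0; apply: omega1_uncountable.
  by rewrite o0; exact: countable0.
exists (fun x =>
  if pselect (exists G : nat -> omega1, (fun n => val (G n)) = h x) is
   left e then projT1 (cid e) else fun=> w0) => G.
have [x Wx hx] := hs (fun n => val (G n)); exists x => //.
case: pselect => [e|]; last by case; exists G.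
apply/funext => n; apply: val_inj.
by case: (cid e) => G' /= G'h; rewrite -[RHS]/((fun n => val (G n)) n) -hx -G'h.
Qed.

Lemma wo_le_max (s : seq (set nat)) : s != [::] ->
  exists2 x, x \in s & forall y, y \in s -> wo_le y x.
Proof.
elim: s => // x [|y s] IH _.
  by exists x; rewrite ?inE // => z; rewrite inE => /eqP->; exact: wo_le_refl.
have [//|z zs zmax] := IH.
have [xz|zx] := orP (wo_le_total x z).
  exists z; first by rewrite inE zs orbT.
  by move=> w; rewrite inE => /orP[/eqP->//|]; exact: zmax.
exists x; first by rewrite inE eqxx.
move=> w; rewrite inE => /orP[/eqP->|/zmax wz]; first exact: wo_le_refl.
exact: wo_le_trans zx.
Qed.

Lemma eq_cap (f g : set nat -> set nat) s :
  (forall X, X \in s -> f X = g X) -> cap f s = cap g s.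
Proof.
move=> fg; apply/seteqP; split=> q sq X sX; first by rewrite -fg //; exact: sq.
by rewrite fg //; exact: sq.
Qed.

Lemma tower_exists : MA_sigma_centered ->
  exists (W : set (set nat)) (f : set nat -> set nat),
    (forall s, (forall X, X \in s -> W X) -> somewhere_dense (cap f s)) /\
    forall G : nat -> omega1, exists2 x, W x &
      otype_le (G @` f x) omega_squared.
Proof.
move=> MA; have [W [Wlarge Wseg]] := initial_continuum.
have [H Hs] := large_omega1_seq Wlarge.
pose below x (s : seq (set nat)) := forall X, X \in s -> W X /\ wo_lt X x.
pose good x g := [set A | otype_le (H x @` A) omega_squared /\
  forall s, below x s -> somewhere_dense (cap g s `&` A)].
(* The empty set extends a function on the predecessors of [x] to a total one; lists below [x] never
   reach this default. *)
pose cut x g := fun y =>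
  if pselect (wo_lt y x) is left yx then g y yx else set0 : set nat.
pose F x (g : forall y, wo_lt y x -> set nat) := xget set0 (good x (cut x g)).
pose f : set nat -> set nat := Fix wo_lt_wf (fun _ => set nat) F.
have fE x : f x = xget set0 (good x f).
  rewrite /f Fix_eq -/f.
    rewrite /F; congr (xget _ _); apply/seteqP.
    have capE s : below x s -> cap (cut x (fun y _ => f y)) s = cap f s.
      move=> xs; apply: eq_cap => X /xs[_ Xx]; rewrite /cut.
      by case: pselect.
    by split=> A [AH As]; split=> // s xs; [rewrite -capE|rewrite capE] => //;
      exact: As.
  move=> y g h gh; congr (F y _).
  apply/functional_extensionality_dep => z.
  exact/functional_extensionality_dep.
have Wmax (s : seq (set nat)) : (forall X, X \in s -> W X) -> s != [::] ->
    exists2 x, W x & forall X, X \in s -> W X /\ wo_le X x.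
  move=> sW /wo_le_max[x xs xmax]; exists x; first exact: sW.
  by move=> X Xs; split; [exact: sW|exact: xmax].
(* The step applies because fewer than continuum many indices in [W] precede [x], so [xget] returns
   a good set and not its default. *)
have capW x : W x -> (forall s, below x s -> somewhere_dense (cap f s)) ->
    good x f (f x).
  move=> Wx xs; rewrite fE; apply: xgetPex.
  have [t Gt] := omega1_strict_bound (H x).
  by have [A [AH As]] := stage Gt MA (Wseg x Wx) xs; exists A.
(* Induction on an upper bound [x] of the list: removing [x] leaves a list below [x], to which
   goodness of [f x] applies. That goodness uses the induction hypothesis at the maximum of each
   nonempty list below [x]. *)
have sd x : W x -> forall s : seq (set nat),
    (forall X, X \in s -> W X /\ wo_le X x) ->
    somewhere_dense (cap f s).
  elim/(well_founded_ind wo_lt_wf): x => x IH Wx.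
  have [_ gx] : good x f (f x).
    apply: capW => // s xs; have [->|s0] := eqVneq s [::].
      by apply: somewhere_denseS somewhere_denseT => q _ X.
    have [y ys ymax] := wo_le_max s0; have [Wy yx] := xs y ys.
    by apply: (IH y) => // X Xs; split; [have [] := xs X Xs|exact: ymax].
  move=> s xs; apply: somewhere_denseS (gx [seq X <- s | X != x] _).
    move=> q [sq xq] X Xs; have [->//|Xx] := eqVneq X x.
    by apply: sq; rewrite mem_filter Xx.
  move=> X; rewrite mem_filter => /andP[/eqP Xx /xs[WX Xlx]].
  by split.
exists W, f; split=> [s sW|G].
  have [->|s0] := eqVneq s [::].
    by apply: somewhere_denseS somewhere_denseT => q _ X.
  by have [x Wx xs] := Wmax s sW s0; exact: (sd x).
have [x Wx <-] := Hs G; exists x => //.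
have xP s : below x s -> somewhere_dense (cap f s).
  by move=> xs; apply: (sd x) => // X /xs[WX []].
by have [] := capW x Wx xP.
Qed.

(** * The filter and its extension to an ultrafilter *)

Theorem theorem4p3 :
  MA_sigma_centered ->
  exists u : set_system nat,
    ordinal_ultrafilter omega_squared u /\ ~ nowhere_dense_ultrafilter u.
Proof.
move=> /tower_exists[W [f [fW fG]]].
(* [S] is in [F] if it contains some finite intersection up to a set that is not somewhere dense. *)
pose F := [set S | exists2 s : seq (set nat), (forall X, X \in s -> W X) &
  ~ somewhere_dense (cap f s `\` S)].
have FF : ProperFilter F.
  split=> [[s /fW sd]|]; first by rewrite setD0.
  split.
  - by exists [::] => //; rewrite setDT; exact: somewhere_dense0.
  - move=> S T [s sW nS] [r rW nT]; exists (s ++ r).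
      by move=> X; rewrite mem_cat => /orP[/sW|/rW].
    move=> sd; have : somewhere_dense ((cap f s `\` S) `|` (cap f r `\` T)).
      apply: somewhere_denseS sd => q [+ nST]; rewrite cap_cat => -[sq rq].
      have [Sq|nSq] := pselect (S q); [right|left]; split=> // Tq.
      exact: nST.
    by move=> /somewhere_denseU[].
  - move=> S T ST [s sW nS]; exists s => // sd; apply: nS.
    by apply: somewhere_denseS sd => q [sq nTq]; split=> // /ST.
have [u [uU Fu]] := ultraFilterLemma FF.
exists u; split; [split=> // G|move=> [_ /(_ (cantor_pt \o str))[A uA]]].
  have [x Wx xG] := fG G; exists (f x) => //; apply: Fu; exists [:: x].
    by move=> X; rewrite inE => /eqP->.
  move=> sd; apply: somewhere_dense0; apply: somewhere_denseS sd.
  by move=> q [xq] /(_ (xq x (mem_head _ _))).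
(* If [A] were not somewhere dense, its complement would be in [F], witnessed by the empty list, and
   hence in [u]. *)
apply: somewhere_dense_cantor; apply: contrapT => nA.
have /Fu uCA : F (~` A).
  exists [::] => // sd; apply: nA.
  by apply: somewhere_denseS sd => q [_ /contrapT].
apply: (@filter_not_empty _ u); rewrite -(setICr A); exact: filterI.
Qed.
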